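(* For any field $\mathbb{F}$, $l_0(M_3(\mathbb{F}))=4$; that is, the maximum of $l_0(\mathcal S)$ over all finite generating sets $\mathcal S$ of $M_3(\mathbb{F})$ equals $4$.
   Context: For a finite subset $\mathcal S$ of $M_n(\mathbb{F})$: a word of length $m$ in $\mathcal S$ is a product $S_1\cdots S_m$ with $S_j\in\mathcal S$. $\mathcal L_k^0(\mathcal S)$ is the linear span of all words of length between $1$ and $k$ (the identity is not automatically included). $\mathcal S$ is a generating set of $M_n(\mathbb{F})$ if the algebra it generates is $M_n(\mathbb{F})$. $l_0(\mathcal S)$ is the smallest $k$ with $\mathcal L_k^0(\mathcal S)=\mathcal L_{k+1}^0(\mathcal S)$, and $l_0(M_n(\mathbb{F}))$ is the maximum of $l_0(\mathcal S)$ over all finite generating sets $\mathcal S$ of $M_n(\mathbb{F})$. *)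

(* Defs.v *)
From HB Require Import structures.
From mathcomp Require Import all_boot all_order all_algebra.
Set Implicit Arguments. Unset Strict Implicit. Unset Printing Implicit Defensive.
Import GRing.Theory.
Local Open Scope ring_scope.

(* Finite subsets of M_n(F) are given as finite lists S : seq 'M[F]_n. *)

Fixpoint words (F : fieldType) (n : nat) (S : seq 'M[F]_n.+1) (m : nat)
  : seq 'M[F]_n.+1 :=
  match m with
  | 0 => [:: 1]
  | m'.+1 => [seq A * B | A <- S, B <- words S m']
  end.

Definition L0 (F : fieldType) (n : nat) (S : seq 'M[F]_n.+1) (k : nat)
  : {vspace 'M[F]_n.+1} :=
  (\sum_(1 <= m < k.+1) <<words S m>>)%VS.

(* S generates M_n(F): the (unital) subalgebra generated by S is M_n(F),
   i.e. every subspace containing 1 and S and closed under products is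
   the whole space. *)
Definition generating (F : fieldType) (n : nat) (S : seq 'M[F]_n.+1) : Prop :=
  forall U : {vspace 'M[F]_n.+1},
    (1 \in U)%VS ->
    (forall A, A \in S -> (A \in U)%VS) ->
    (forall A B, (A \in U)%VS -> (B \in U)%VS -> (A * B \in U)%VS) ->
    U = fullv.

Definition is_l0 (F : fieldType) (n : nat) (S : seq 'M[F]_n.+1) (k : nat) : Prop :=
  L0 S k = L0 S k.+1 /\ forall j, (j < k)%N -> L0 S j <> L0 S j.+1.

Definition is_l0_Mn (F : fieldType) (n : nat) (v : nat) : Prop :=
  (exists S : seq 'M[F]_n.+1, generating S /\ is_l0 S v) /\
  (forall (S : seq 'M[F]_n.+1) (k : nat), generating S -> is_l0 S k -> (k <= v)%N).

(* Main.v *)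
Require Import Defs.
From HB Require Import structures.
From mathcomp Require Import all_boot all_order all_algebra.
From mathcomp Require Import falgebra zify.

Set Implicit Arguments.
Unset Strict Implicit.
Unset Printing Implicit Defensive.
Import GRing.Theory.
Local Open Scope ring_scope.

(** Let V be the span of S and L_k = V + V^2 + ... + V^k, of dimension d_k.
    If L_(k+1) = L_k, then L_k is an ideal, so L_k = M_3. Assume L_4 <> M_3.
    If d_(k+1) <= d_k + 1, then d_(k+2) <= d_(k+1) + 1, and L_(k+2) / L_(k+1) is
    spanned by the powers x^(k+2) with x in V, which lie in L_(k+1) for k >= 2
    by Cayley-Hamilton.  Hence d_1 >= 2 and d_(k+1) >= d_k + 2 for k = 1, 2, 3,
    which leaves only d_1 = 2 and d_2 = 4.  Then V = <A, B> with A^2 not in V,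
    and L_2 / V is spanned by A^2 and one of AB, BA, B^2.  Accordingly L_3 / L_2
    is spanned by A^3 and one of A^2 B, B A^2, B^3; multiplying once more only
    produces words containing a cube, so L_4 = L_3 by Cayley-Hamilton.
    The value 4 is attained by the pair E_12 + E_23, E_31. *)

(** * Sums of powers of a subspace *)

(** The space L_k of the overview, made to depend only on the span V of the letters, so that a
    convenient basis of V can be chosen later; [L0E] makes the link with words. *)
Definition powers_sum (F : fieldType) (aT : falgType F) (V : {vspace aT}) (k : nat) :
  {vspace aT} := (\sum_(1 <= m < k.+1) V ^+ m)%VS.

(** [U * V] is spanned by the products of basis vectors, so one of these must escape [W]. *)
Lemma prodvPn (F : fieldType) (aT : falgType F) (U V W : {vspace aT}) :
  ~~ (U * V <= W)%VS -> exists u v, [/\ u \in U, v \in V & u * v \notin W].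
Proof.
move=> nUVW.
have /allPn[_ /allpairsP[[u v] /= [uU vV ->]] nW] :
  ~~ all [in W] [seq u * v | u <- vbasis U, v <- vbasis V].
  by apply: contra nUVW => /allP h; rewrite unlock; apply/span_subvP.
by exists u, v; split=> //; exact: vbasis_mem.
Qed.

Lemma powers_sum0 (F : fieldType) (aT : falgType F) (V : {vspace aT}) :
  powers_sum V 0 = 0%VS.
Proof. by rewrite /powers_sum big_geq. Qed.

Lemma powers_sumS (F : fieldType) (aT : falgType F) (V : {vspace aT}) k :
  powers_sum V k.+1 = (powers_sum V k + V ^+ k.+1)%VS.
Proof. by rewrite /powers_sum big_nat_recr. Qed.

Lemma powers_sum1 (F : fieldType) (aT : falgType F) (V : {vspace aT}) :
  powers_sum V 1 = V.
Proof. by rewrite powers_sumS powers_sum0 add0v expv1. Qed.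

Lemma powers_sumSl (F : fieldType) (aT : falgType F) (V : {vspace aT}) k :
  powers_sum V k.+1 = (V + V * powers_sum V k)%VS.
Proof.
elim: k => [|k IH]; first by rewrite powers_sum1 powers_sum0 prodv0 addv0.
by rewrite powers_sumS {1}IH expvSl -addvA -prodvDr -powers_sumS.
Qed.

Lemma powers_sumSr (F : fieldType) (aT : falgType F) (V : {vspace aT}) k :
  powers_sum V k.+1 = (V + powers_sum V k * V)%VS.
Proof.
elim: k => [|k IH]; first by rewrite powers_sum1 powers_sum0 prod0v addv0.
by rewrite powers_sumS {1}IH expvSr -addvA -prodvDl -powers_sumS.
Qed.

Lemma powers_sum_leS (F : fieldType) (aT : falgType F) (V : {vspace aT}) k :
  (powers_sum V k <= powers_sum V k.+1)%VS.
Proof. by rewrite powers_sumS addvSl. Qed.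

Lemma powers_sum_le (F : fieldType) (aT : falgType F) (V : {vspace aT}) j k :
  (j <= k)%N -> (powers_sum V j <= powers_sum V k)%VS.
Proof.
move=> /subnKC <-; elim: (k - j)%N => [|i IH]; first by rewrite addn0.
by rewrite addnS (subv_trans IH) ?powers_sum_leS.
Qed.

Lemma exp_powers_sum (F : fieldType) (aT : falgType F) (V : {vspace aT}) k :
  (0 < k)%N -> (V ^+ k <= powers_sum V k)%VS.
Proof. by case: k => // k _; rewrite powers_sumS addvSr. Qed.

Lemma memv_mul_powers_suml (F : fieldType) (aT : falgType F) (V : {vspace aT}) k x u :
  x \in V -> u \in powers_sum V k -> x * u \in powers_sum V k.+1.
Proof.
move=> xV uL; rewrite powers_sumSl; apply: (subvP (addvSr _ _)).
exact: memv_mul.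
Qed.

Lemma memv_mul_powers_sumr (F : fieldType) (aT : falgType F) (V : {vspace aT}) k x u :
  x \in V -> u \in powers_sum V k -> u * x \in powers_sum V k.+1.
Proof.
move=> xV uL; rewrite powers_sumSr; apply: (subvP (addvSr _ _)).
exact: memv_mul.
Qed.

(** * Growth of the dimension of L_k *)

Lemma subv_adjoin_line (F : fieldType) (vT : vectType F) (U W : {vspace vT}) v :
  (U <= W)%VS -> (\dim W <= (\dim U).+1)%N -> v \in W -> v \notin U ->
  (W <= U + <[v]>)%VS.
Proof.
move=> UW dW vW vU.
have UvW : (U + <[v]> <= W)%VS by rewrite subv_add UW -memvE.
suff /eqP E : (U + <[v]> == W)%VS by rewrite E subvv.
rewrite eqEdim UvW (leq_trans dW) //.
rewrite ltnNge; apply: contra vU => le.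
have /eqP -> : (U == U + <[v]>)%VS by rewrite eqEdim addvSl.
by rewrite memvE addvSr.
Qed.

Lemma dim_add_line (F : fieldType) (vT : vectType F) (U : {vspace vT}) v :
  (\dim (U + <[v]>) <= (\dim U).+1)%N.
Proof.
apply: (leq_trans (dimv_add_leqif _ _)).
by rewrite -addn1 leq_add2l dim_vline leq_b1.
Qed.

(** If p x with p in V^k and x in V escapes L_k, slow growth gives L_(k+1) = L_k + <p x>. Two
    substitutions of this form into a word y p x then show that the single vector p x x spans
    L_(k+2) modulo L_(k+1). *)
Lemma slow_growth_propagates (F : fieldType) (aT : falgType F) (V : {vspace aT}) k :
  (\dim (powers_sum V k.+1) <= (\dim (powers_sum V k)).+1)%N ->
  (\dim (powers_sum V k.+2) <= (\dim (powers_sum V k.+1)).+1)%N.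
Proof.
move=> dk.
have [VkL|/prodvPn[p [x [pV xV npx]]]] :=
    boolP (V ^+ k * V <= powers_sum V k)%VS.
  (* Here V^(k+1) lies in L_k, so V^(k+2) = V V^(k+1) lies in L_(k+1) and there is no growth at
     all. *)
  rewrite ltnW // ltnS dimvS // powers_sumS subv_add subvv /= expvSl expvSr.
  apply: (@subv_trans _ _ (V * powers_sum V k)%VS); first exact: prodvSr.
  by rewrite powers_sumSl addvSr.
have pxL : p * x \in powers_sum V k.+1.
  apply: (subvP (exp_powers_sum _ _)) => //.
  by rewrite expvSr; exact: memv_mul.
have Lsub := subv_adjoin_line (powers_sum_leS V k) dk pxL npx.
apply: (leq_trans _ (dim_add_line _ (p * x * x))).
apply: dimvS; rewrite {1}powers_sumSl subv_add.
apply/andP; split.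
  by apply: subv_trans (addvSl _ _); rewrite powers_sumSl addvSl.
apply/prodvP => y u yV /(subvP Lsub)/memv_addP[l lL [_ /vlineP[c ->] ->]].
rewrite mulrDr memvD //.
  by apply: (subvP (addvSl _ _)); exact: memv_mul_powers_suml.
rewrite -scalerAr memvZ // mulrA.
(* Regrouped as (y p) x, the word admits a second substitution, now for y p. *)
have /(subvP Lsub)/memv_addP[l' l'L [_ /vlineP[c' ->] ->]] :
    y * p \in powers_sum V k.+1.
  apply: (subvP (exp_powers_sum _ _)) => //.
  by rewrite expvSl; exact: memv_mul.
rewrite mulrDl memvD //.
  by apply: (subvP (addvSl _ _)); exact: memv_mul_powers_sumr.
by rewrite -scalerAl memvZ // (subvP (addvSr _ _)) ?memv_line.
Qed.

(* A word y p x outside L_{k+1} forces p x x outside L_{k+1}: iterating, x^{k+2}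
   would lie outside L_{k+1}. *)
Lemma slow_growth_stops (F : fieldType) (aT : falgType F) (V : {vspace aT}) k :
  (\dim (powers_sum V k.+1) <= (\dim (powers_sum V k)).+1)%N ->
  (forall x, x \in V -> x ^+ k.+2 \in powers_sum V k.+1) ->
  (powers_sum V k.+2 <= powers_sum V k.+1)%VS.
Proof.
move=> dk pow.
have step y p x : y \in V -> x \in V -> p \in (V ^+ k)%VS ->
    p * x * x \in powers_sum V k.+1 -> y * p * x \in powers_sum V k.+1.
  move=> yV xV pV pxx.
  have [px|npx] := boolP (p * x \in powers_sum V k).
    by rewrite -mulrA memv_mul_powers_suml.
  have pxL : p * x \in powers_sum V k.+1.
    apply: (subvP (exp_powers_sum _ _)) => //.
    by rewrite expvSr; exact: memv_mul.
  have Lsub := subv_adjoin_line (powers_sum_leS V k) dk pxL npx.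
  have /(subvP Lsub)/memv_addP[l lL [_ /vlineP[c ->] ->]] :
      y * p \in powers_sum V k.+1.
    apply: (subvP (exp_powers_sum _ _)) => //.
    by rewrite expvSl; exact: memv_mul.
  rewrite mulrDl memvD //; first exact: memv_mul_powers_sumr.
  by rewrite -scalerAl memvZ.
(* Words of length k+2 ending in at least j+1 letters x. Each induction step trades a leading letter
   for one more trailing x, down to x^(k+2); the case j = 0 covers all words ending in x. *)
have words_end x i j : x \in V -> (i + j)%N = k.+1 ->
    (V ^+ i * <[x ^+ j.+1]> <= powers_sum V k.+1)%VS.
  move=> xV; elim: i j => [|i IH] j ij.
    by rewrite expv0 prod1v -memvE -[j]add0n ij pow.
  case: ij => ij.
  rewrite expvSl -prodvA exprSr -prodv_line (prodvA (V ^+ i)%VS) -limg_amulr.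
  apply/prodvP => y _ yV /memv_imgP[p pU ->]; rewrite lfunE /= mulrA.
  apply: step => //.
    apply: subvP pU; rewrite -ij expvD; apply: prodvSr.
    by rewrite -expv_line; apply: expvS; rewrite -memvE.
  have/subvP := IH j.+1 (etrans (addnS _ _) (congr1 S ij)); apply.
  rewrite -mulrA !exprSr -mulrA -prodv_line prodvA.
  by apply: memv_mul; rewrite ?memv_line.
rewrite powers_sumS subv_add subvv expvSr /=; apply/prodvP => p x pV xV.
apply: (subvP (words_end x k.+1 0%N xV (addn0 _))).
by rewrite expr1 memv_mul ?memv_line.
Qed.

(** * From L_3 to L_4 with two letters *)

Lemma powers_sum_mull (F : fieldType) (aT : falgType F) (V X : {vspace aT}) k :
  (X <= V)%VS -> (X * powers_sum V k <= powers_sum V k.+1)%VS.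
Proof.
move=> XV; rewrite powers_sumSl; apply: subv_trans (addvSr _ _).
exact: prodvSl.
Qed.

Lemma powers_sum_mulr (F : fieldType) (aT : falgType F) (V X : {vspace aT}) k :
  (X <= V)%VS -> (powers_sum V k * X <= powers_sum V k.+1)%VS.
Proof.
move=> XV; rewrite powers_sumSr; apply: subv_trans (addvSr _ _).
exact: prodvSr.
Qed.

Lemma sub_powers_sum (F : fieldType) (aT : falgType F) (V : {vspace aT}) k :
  (V <= powers_sum V k.+1)%VS.
Proof. by rewrite -{1}[V]powers_sum1 powers_sum_le. Qed.

Lemma prodv_sub_powers_sum2 (F : fieldType) (aT : falgType F) (V X Y : {vspace aT}) :
  (X <= V)%VS -> (Y <= V)%VS -> (X * Y <= powers_sum V 2)%VS.
Proof.
move=> XV YV; apply: subv_trans (powers_sum_mull _ XV); apply: prodvSr.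
exact: subv_trans YV (sub_powers_sum V 0).
Qed.

(** Left multiplication by A controls everything: A L_2 lies in L_2 + <A^3> + <A^2 B>, which is
    therefore all of L_3, since A B X = A (B X). By the two cube hypotheses A L_3 stays in L_3, and
    this absorbs A^2 B X = A (A B X). *)
Lemma two_letters_left (F : fieldType) (aT : falgType F) (V : {vspace aT}) A B :
  V = (<[A]> + <[B]>)%VS ->
  (powers_sum V 2 <= V + <[A * A]> + <[A * B]>)%VS ->
  A ^+ 3 * A \in powers_sum V 3 -> A ^+ 3 * B \in powers_sum V 3 ->
  (powers_sum V 4 <= powers_sum V 3)%VS.
Proof.
move=> VE L2E A4 A3B.
have E3 : A * A * A = A ^+ 3 by rewrite exprSr expr2.
have AV : (<[A]> <= V)%VS by rewrite VE addvSl.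
have BV : (<[B]> <= V)%VS by rewrite VE addvSr.
set P := (powers_sum V 2 + <[A * A * A]> + <[A * A * B]>)%VS.
have LP : (powers_sum V 2 <= P)%VS by rewrite /P -addvA addvSl.
have AAAP : (<[A * A * A]> <= P)%VS.
  exact: subv_trans (addvSr _ _) (addvSl _ _).
have AABP : (<[A * A * B]> <= P)%VS by exact: addvSr.
have AL2 : (<[A]> * powers_sum V 2 <= P)%VS.
  apply: subv_trans (prodvSr _ L2E) _.
  rewrite !prodvDr !prodv_line !mulrA !subv_add AAAP AABP !andbT.
  by apply: subv_trans LP; exact: prodv_sub_powers_sum2.
have ABX X : (<[X]> <= V)%VS -> (<[A * B * X]> <= P)%VS.
  move=> XV; rewrite -mulrA -prodv_line; apply: subv_trans AL2.
  by apply: prodvSr; rewrite -prodv_line prodv_sub_powers_sum2.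
have L3P : (powers_sum V 3 <= P)%VS.
  rewrite powers_sumSr subv_add (subv_trans (sub_powers_sum V 1)) //=.
  apply: subv_trans (prodvSl _ L2E) _.
  rewrite prodvDl subv_add prodvDl subv_add (subv_trans _ LP) /=;
    last exact: prodv_sub_powers_sum2.
  by rewrite VE !prodvDr !prodv_line !subv_add AAAP AABP !ABX.
have AL3 : (<[A]> * powers_sum V 3 <= powers_sum V 3)%VS.
  apply: subv_trans (prodvSr _ L3P) _.
  rewrite !prodvDr !prodv_line !mulrA !subv_add powers_sum_mull //= -!memvE.
  by rewrite E3 A4 A3B.
have AABX X : (<[X]> <= V)%VS -> (<[A * A * B * X]> <= powers_sum V 3)%VS.
  move=> XV; rewrite -2!mulrA -prodv_line; apply: subv_trans AL3.
  apply: prodvSr; rewrite -prodv_line; apply: subv_trans (powers_sum_mull 2 AV).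
  by apply: prodvSr; rewrite -prodv_line prodv_sub_powers_sum2.
rewrite powers_sumSr subv_add sub_powers_sum /=.
apply: subv_trans (prodvSl _ L3P) _.
rewrite prodvDl subv_add prodvDl subv_add powers_sum_mulr //=.
rewrite VE !prodvDr !prodv_line !subv_add -VE !AABX // !andbT -!memvE.
by rewrite E3 A4.
Qed.

(** Mirror image of [two_letters_left], with right multiplication by A. *)
Lemma two_letters_right (F : fieldType) (aT : falgType F) (V : {vspace aT}) A B :
  V = (<[A]> + <[B]>)%VS ->
  (powers_sum V 2 <= V + <[A * A]> + <[B * A]>)%VS ->
  A * A ^+ 3 \in powers_sum V 3 -> B * A ^+ 3 \in powers_sum V 3 ->
  (powers_sum V 4 <= powers_sum V 3)%VS.
Proof.
move=> VE L2E A4 BA3.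
have E3 : A * (A * A) = A ^+ 3 by rewrite exprS expr2.
have AV : (<[A]> <= V)%VS by rewrite VE addvSl.
have BV : (<[B]> <= V)%VS by rewrite VE addvSr.
set P := (powers_sum V 2 + <[A * (A * A)]> + <[B * (A * A)]>)%VS.
have LP : (powers_sum V 2 <= P)%VS by rewrite /P -addvA addvSl.
have AAAP : (<[A * (A * A)]> <= P)%VS.
  exact: subv_trans (addvSr _ _) (addvSl _ _).
have BAAP : (<[B * (A * A)]> <= P)%VS by exact: addvSr.
have L2A : (powers_sum V 2 * <[A]> <= P)%VS.
  apply: subv_trans (prodvSl _ L2E) _.
  rewrite !prodvDl !prodv_line -!mulrA !subv_add AAAP BAAP !andbT.
  by apply: subv_trans LP; exact: prodv_sub_powers_sum2.
have XBA X : (<[X]> <= V)%VS -> (<[X * (B * A)]> <= P)%VS.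
  move=> XV; rewrite mulrA -prodv_line; apply: subv_trans L2A.
  by apply: prodvSl; rewrite -prodv_line prodv_sub_powers_sum2.
have L3P : (powers_sum V 3 <= P)%VS.
  rewrite powers_sumSl subv_add (subv_trans (sub_powers_sum V 1)) //=.
  apply: subv_trans (prodvSr _ L2E) _.
  rewrite prodvDr subv_add prodvDr subv_add (subv_trans _ LP) /=;
    last exact: prodv_sub_powers_sum2.
  by rewrite VE !prodvDl !prodv_line !subv_add AAAP BAAP !XBA.
have L3A : (powers_sum V 3 * <[A]> <= powers_sum V 3)%VS.
  apply: subv_trans (prodvSl _ L3P) _.
  rewrite !prodvDl !prodv_line -!mulrA !subv_add powers_sum_mulr //= -!memvE.
  by rewrite E3 A4 BA3.
have XBAA X : (<[X]> <= V)%VS -> (<[X * (B * (A * A))]> <= powers_sum V 3)%VS.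
  move=> XV; rewrite (mulrA B) mulrA -prodv_line; apply: subv_trans L3A.
  apply: prodvSl; rewrite -prodv_line; apply: subv_trans (powers_sum_mull 2 XV).
  by apply: prodvSr; rewrite -prodv_line prodv_sub_powers_sum2.
rewrite powers_sumSl subv_add sub_powers_sum /=.
apply: subv_trans (prodvSr _ L3P) _.
rewrite prodvDr subv_add prodvDr subv_add powers_sum_mull //=.
rewrite VE !prodvDl !prodv_line !subv_add -VE !XBAA // !andbT -!memvE.
by rewrite E3 A4 BA3.
Qed.

(** Modulo V both A B and B A are multiples of A^2, so the mixed words A^2 B and B^2 A reduce to A^3
    modulo L_2. Thus L_3 = L_2 + <A^3> + <B^3>, and one more letter on the right only meets
    cubes. *)
Lemma two_letters_squares (F : fieldType) (aT : falgType F) (V : {vspace aT}) A B :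
  V = (<[A]> + <[B]>)%VS ->
  A * B \in (V + <[A * A]>)%VS -> B * A \in (V + <[A * A]>)%VS ->
  (powers_sum V 2 <= V + <[A * A]> + <[B * B]>)%VS ->
  (forall x y, x \in V -> y \in V -> x ^+ 3 * y \in powers_sum V 3) ->
  (powers_sum V 4 <= powers_sum V 3)%VS.
Proof.
move=> VE ABE BAE L2E cube.
have AV : (<[A]> <= V)%VS by rewrite VE addvSl.
have BV : (<[B]> <= V)%VS by rewrite VE addvSr.
have E3 x : x * x * x = x ^+ 3 by rewrite exprSr expr2.
set P := (powers_sum V 2 + <[A * A * A]> + <[B * B * B]>)%VS.
have LP : (powers_sum V 2 <= P)%VS by rewrite /P -addvA addvSl.
have AAAP : (<[A * A * A]> <= P)%VS.
  exact: subv_trans (addvSr _ _) (addvSl _ _).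
have BBBP : (<[B * B * B]> <= P)%VS by exact: addvSr.
have XVP X : (<[X]> <= V)%VS -> (<[X]> * V <= P)%VS.
  by move=> XV; apply: subv_trans LP; exact: prodv_sub_powers_sum2.
have AABP : (<[A * A * B]> <= P)%VS.
  rewrite -mulrA -prodv_line.
  apply: (@subv_trans _ _ (<[A]> * (V + <[A * A]>))%VS).
    by apply: prodvSr; rewrite -memvE.
  by rewrite prodvDr prodv_line mulrA subv_add XVP.
have BAAP : (<[B * A * A]> <= P)%VS.
  rewrite -prodv_line.
  apply: (@subv_trans _ _ ((V + <[A * A]>) * <[A]>)%VS).
    by apply: prodvSl; rewrite -memvE.
  rewrite prodvDl prodv_line subv_add AAAP andbT.
  by apply: subv_trans LP; exact: prodv_sub_powers_sum2.
(* B^2 A = B (B A) reduces to B A^2, which has just been treated. *)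
have BBAP : (<[B * B * A]> <= P)%VS.
  rewrite -mulrA -prodv_line.
  apply: (@subv_trans _ _ (<[B]> * (V + <[A * A]>))%VS).
    by apply: prodvSr; rewrite -memvE.
  by rewrite prodvDr prodv_line mulrA subv_add XVP.
have L3P : (powers_sum V 3 <= P)%VS.
  rewrite powers_sumSr subv_add (subv_trans (sub_powers_sum V 1)) //=.
  apply: subv_trans (prodvSl _ L2E) _.
  rewrite prodvDl subv_add prodvDl subv_add (subv_trans _ LP) /=;
    last exact: prodv_sub_powers_sum2.
  by rewrite VE !prodvDr !prodv_line !subv_add AAAP AABP BBAP BBBP.
rewrite powers_sumSr subv_add sub_powers_sum /=.
apply: subv_trans (prodvSl _ L3P) _.
rewrite prodvDl subv_add prodvDl subv_add powers_sum_mulr //= !E3.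
by apply/andP; split; apply/prodvP=> _ y /vlineP[c ->] yV;
  rewrite -scalerAl memvZ // cube // memvE.
Qed.

(** * The dimension count *)

(* Some square x^2 escapes V, for otherwise a^2, b^2 and a b + b a lie in V. *)
Lemma square_notin (F : fieldType) (aT : falgType F) (V : {vspace aT}) :
  \dim V = 2%N -> (\dim V + 2 <= \dim (powers_sum V 2))%N ->
  exists2 x, x \in V & x * x \notin V.
Proof.
move=> dV dL.
have: size (vbasis V) = 2%N by rewrite size_tuple.
case E: (tval (vbasis V)) => [|a [|b [|//]]] // _.
have VE : V = (<[a]> + <[b]>)%VS.
  by rewrite -(span_basis (vbasisP V)) E span_cons span_seq1.
have aV : a \in V by rewrite VE memvE addvSl.
have bV : b \in V by rewrite VE memvE addvSr.
have [aaV|] := boolP (a * a \in V); last by exists a.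
have [bbV|] := boolP (b * b \in V); last by exists b.
have [abV|] := boolP ((a + b) * (a + b) \in V); last by exists (a + b); rewrite ?memvD.
(* Now b a equals -a b modulo V, so L_2 lies in [U], of dimension at most 3, while the hypotheses
   require at least 4. *)
pose U := (V + <[a * b]>)%VS.
have VU z : z \in V -> z \in U by exact: (subvP (addvSl _ _)).
have abU : a * b \in U by rewrite memvE addvSr.
have baU : b * a \in U.
  have := VU _ abV; rewrite mulrDl !mulrDr.
  by rewrite (rpredDl _ (rpredD (VU _ aaV) abU)) (rpredDr _ (VU _ bbV)).
have : (powers_sum V 2 <= U)%VS.
  rewrite powers_sumS powers_sum1 subv_add addvSl /= expv2 {1 2}VE.
  by rewrite !prodvDl !prodvDr !prodv_line !subv_add -!memvE abU baU !VU.
move/dimvS/(leq_trans dL)/leq_trans/(_ (dim_add_line _ _)).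
by rewrite dV.
Qed.

Lemma line_complement (F : fieldType) (vT : vectType F) (V : {vspace vT}) x :
  \dim V = 2%N -> x \in V -> x != 0 -> exists y, V = (<[x]> + <[y]>)%VS.
Proof.
move=> dV xV x0.
have /subvPn[y yV yx] : ~~ (V <= <[x]>)%VS.
  by apply/negP => /dimvS; rewrite dV dim_vline x0.
exists y; apply/eqP; rewrite eqEsubv subv_add -!memvE xV yV !andbT.
by rewrite subv_adjoin_line // -?memvE // dV dim_vline x0.
Qed.

(** The relation for x^3 has a constant term, and 1 need not lie in any L_k. Multiplying by a letter
    y turns 1, x, x^2 into words of lengths 1, 2, 3. *)
Lemma cube_mul_mem (F : fieldType) (aT : falgType F) (V : {vspace aT}) x y :
  x \in V -> y \in V -> x ^+ 3 \in (<[1]> + <[x]> + <[x * x]>)%VS ->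
  (x ^+ 3 * y \in powers_sum V 3) /\ (y * x ^+ 3 \in powers_sum V 3).
Proof.
move=> xV yV /memv_addP[_ /memv_addP[_ /vlineP[a ->] [_ /vlineP[b ->] ->]]
  [_ /vlineP[c ->] ->]].
have mulL2 u v : u \in V -> v \in V -> u * v \in powers_sum V 2.
  by move=> uV vV; rewrite memv_mul_powers_suml ?powers_sum1.
have L23 : (powers_sum V 2 <= powers_sum V 3)%VS by exact: powers_sum_leS.
have y3 : y \in powers_sum V 3 by exact: subvP (sub_powers_sum V 2) _ yV.
rewrite !mulrDl !mulrDr -!scalerAl -!scalerAr mul1r mulr1; split.
  apply: rpredD; first by rewrite rpredD // memvZ // (subvP L23) ?mulL2.
  by rewrite memvZ // memv_mul_powers_sumr ?mulL2.
apply: rpredD; first by rewrite rpredD // memvZ // (subvP L23) ?mulL2.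
by rewrite memvZ // memv_mul_powers_suml ?mulL2.
Qed.

Lemma powers_sum4_dim (F : fieldType) (aT : falgType F) (V : {vspace aT}) :
  (forall x, x \in V -> x ^+ 3 \in (<[1]> + <[x]> + <[x * x]>)%VS) ->
  ~~ (powers_sum V 4 <= powers_sum V 3)%VS ->
  ~~ (powers_sum V 5 <= powers_sum V 4)%VS ->
  (9 <= \dim (powers_sum V 4))%N.
Proof.
move=> CH n43 n54.
have cubel x y : x \in V -> y \in V -> x ^+ 3 * y \in powers_sum V 3.
  by move=> xV yV; case: (cube_mul_mem xV yV (CH x xV)).
have cuber x y : x \in V -> y \in V -> y * x ^+ 3 \in powers_sum V 3.
  by move=> xV yV; case: (cube_mul_mem xV yV (CH x xV)).
(* Slow growth here would force L_5 = L_4, because x^5 = x (x^3 x) lies in L_4. *)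
have g3 : (\dim (powers_sum V 3) + 2 <= \dim (powers_sum V 4))%N.
  rewrite addn2 ltnNge; apply: contra n54 => /slow_growth_stops; apply=> x xV.
  by rewrite exprS memv_mul_powers_suml // exprSr cubel.
have slow2 : ~~ (\dim (powers_sum V 3) <= (\dim (powers_sum V 2)).+1)%N.
  apply: contra n43 => /slow_growth_stops; apply=> x xV.
  by rewrite exprSr cubel.
(* Contraposition carries growth by at least 2 down to k = 0, where L_0 = 0 and it reads d_1 >=
   2. *)
have slow1 := contra (@slow_growth_propagates _ _ V 1) slow2.
have slow0 := contra (@slow_growth_propagates _ _ V 0) slow1.
rewrite -ltnNge powers_sum1 powers_sum0 dimv0 in slow0.
rewrite -ltnNge powers_sum1 in slow1.
rewrite -ltnNge in slow2.
rewrite leqNgt; apply/negP => small.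
(* Four increments of at least 2 with total at most 8 must all equal 2. *)
have dV : \dim V = 2%N by lia.
have d2 : \dim (powers_sum V 2) = 4%N by lia.
have [A AV nAA] : exists2 x, x \in V & x * x \notin V.
  by apply: square_notin; rewrite ?d2 dV.
have A0 : A != 0 by apply: contra nAA => /eqP ->; rewrite mul0r mem0v.
have [B VE] := line_complement dV AV A0.
have BV : B \in V by rewrite VE memvE addvSr.
pose U := (V + <[A * A]>)%VS.
have VL2 : (V <= powers_sum V 2)%VS by exact: sub_powers_sum.
have mulL2 x y : x \in V -> y \in V -> x * y \in powers_sum V 2.
  by move=> xV yV; rewrite memv_mul_powers_suml ?powers_sum1.
have UL2 : (U <= powers_sum V 2)%VS by rewrite subv_add VL2 -memvE mulL2.
(* [U] has dimension at least 3, so codimension at most 1 in L_2: any product of letters outside [U]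
   completes it to L_2. *)
have dU : (\dim (powers_sum V 2) <= (\dim U).+1)%N.
  rewrite d2 ltnS ltnNge; apply: contra nAA => dU.
  have /eqP -> : (V == U)%VS by rewrite eqEdim addvSl dV.
  by rewrite memvE addvSr.
have adjoin x y : x \in V -> y \in V -> x * y \notin U ->
    (powers_sum V 2 <= U + <[x * y]>)%VS.
  by move=> xV yV; apply: subv_adjoin_line => //; exact: mulL2.
apply: (negP n43).
have [ABU|/(adjoin _ _ AV BV) sub] := boolP (A * B \in U); last first.
  by apply: two_letters_left sub _ _ => //; exact: cubel.
have [BAU|/(adjoin _ _ BV AV) sub] := boolP (B * A \in U); last first.
  by apply: two_letters_right sub _ _ => //; exact: cuber.
have [BBU|/(adjoin _ _ BV BV) sub] := boolP (B * B \in U); last first.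
  exact: two_letters_squares sub cubel.
(* With all products of letters in [U], L_2 would have dimension at most 3. *)
have : (powers_sum V 2 <= U)%VS.
  rewrite powers_sumS powers_sum1 subv_add addvSl /= expv2 {1 2}VE.
  rewrite !prodvDl !prodvDr !prodv_line !subv_add -!memvE ABU BAU BBU !andbT.
  by rewrite memvE addvSr.
by move/dimvS/leq_trans/(_ (dim_add_line _ _)); rewrite d2 dV.
Qed.

(** * Words, simplicity of matrix algebras, and the upper bound *)

Lemma span_allpairs_mul (F : fieldType) (aT : falgType F) (S T : seq aT) :
  <<[seq (A * B)%R | A <- S, B <- T]>>%VS = (<<S>> * <<T>>)%VS.
Proof.
elim: S => [|A S IH] /=; first by rewrite span_nil prod0v.
rewrite span_cat IH span_cons prodvDl; congr (_ + _)%VS.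
elim: T {IH} => [|B T IH] /=; first by rewrite span_nil prodv0.
by rewrite !span_cons IH prodvDr prodv_line.
Qed.

Lemma L0E (F : fieldType) n (S : seq 'M[F]_n.+1) k : L0 S k = powers_sum <<S>>%VS k.
Proof.
rewrite /L0 /powers_sum; apply: eq_bigr => m _.
elim: m => [|m IH] /=; first by rewrite span_seq1.
by rewrite span_allpairs_mul IH expvSl.
Qed.

Lemma powers_sum_closed (F : fieldType) (aT : falgType F) (V : {vspace aT}) k :
  (powers_sum V k.+1 <= powers_sum V k)%VS ->
  (powers_sum V k * powers_sum V k <= powers_sum V k)%VS.
Proof.
move=> stable.
have VL : (V * powers_sum V k <= powers_sum V k)%VS.
  exact: subv_trans (powers_sum_mull _ (subvv V)) stable.
(* The right factor stays fixed while letters are peeled off the left one. *)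
suff jP j : (powers_sum V j * powers_sum V k <= powers_sum V k)%VS by [].
elim: j => [|j IH]; first by rewrite powers_sum0 prod0v sub0v.
rewrite powers_sumSl prodvDl subv_add VL -prodvA /=.
exact: subv_trans (prodvSr _ IH) VL.
Qed.

(* The span L of all words is an ideal, as L + <1> is everything; M_n is simple. *)
Lemma generating_stable_full (F : fieldType) n (S : seq 'M[F]_n.+2) k :
  generating S -> (powers_sum <<S>> k.+1 <= powers_sum <<S>> k)%VS ->
  powers_sum <<S>>%VS k = fullv.
Proof.
set L := powers_sum _ k => gen stable.
have LL := powers_sum_closed stable; rewrite -/L in LL.
have SL A : A \in S -> A \in L.
  move=> AS; apply: (subvP stable); apply: (subvP (sub_powers_sum _ _)).
  exact: memv_span.
have L1 : (L + <[1]>)%VS = fullv.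
  apply: gen => [|A AS|A B].
  - by rewrite memvE addvSr.
  - by apply: (subvP (addvSl _ _)); exact: SL.
  move=> AU BU; have := memv_mul AU BU; apply: subvP.
  by rewrite prodvDl !prodvDr !prodv1 prod1v !subv_add (subv_trans LL) ?addvSl ?addvSr.
have idl A B : B \in L -> A * B \in L.
  have : A \in fullv by exact: memvf.
  rewrite -L1 => /memv_addP[l lL [_ /vlineP[c ->] ->]] BL.
  rewrite mulrDl -scalerAl mul1r memvD ?memvZ //.
  by apply: (subvP LL); exact: memv_mul.
have idr A B : B \in L -> B * A \in L.
  have : A \in fullv by exact: memvf.
  rewrite -L1 => /memv_addP[l lL [_ /vlineP[c ->] ->]] BL.
  rewrite mulrDr -scalerAr mulr1 memvD ?memvZ //.
  by apply: (subvP LL); exact: memv_mul.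
(* If L were 0, the line <1> would be the whole algebra; this is where matrix size at least 2
   enters. *)
have /eqP Lneq0 : L != 0%VS.
  apply/eqP => L0; have := congr1 (@dimv _ _) L1.
  by rewrite L0 add0v dim_vline oner_neq0 dimvf /dim /=; lia.
have [M ML Mneq0] : exists2 M, M \in L & M != 0.
  exists (vpick L); first exact: memv_pick.
  by rewrite vpick0; apply/eqP.
have /matrix0Pn[i [j Mij]] := Mneq0.
apply/eqP; rewrite eqEsubv subvf /=; apply/subvP => A _.
rewrite (matrix_sum_delta A); apply: memv_suml => a _; apply: memv_suml => b _.
apply: memvZ.
(* A nonzero entry M_ij yields every matrix unit: E_ai M E_jb = M_ij E_ab. *)
suff -> : delta_mx a b = (M i j)^-1 *: (delta_mx a i * M * delta_mx j b).
  by rewrite memvZ // idr // idl.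
apply: (scalerI Mij); rewrite scalerA mulfV // scale1r.
apply/matrixP => u v; rewrite !mxE (bigD1 j) //= [X in _ = _ + X]big1 => [|w wj].
  rewrite !mxE (bigD1 i) //= [X in (_ + X) * _]big1 => [|w wi]; last first.
    by rewrite !mxE (negPf wi) andbF mul0r.
  rewrite !mxE !eqxx !addr0 andbT /=.
  by do 2!case: eqP => _; rewrite ?(mul1r, mulr1, mul0r, mulr0).
by rewrite [X in _ * X]mxE (negPf wj) mulr0.
Qed.

Lemma cube_mem (F : fieldType) (A : 'M[F]_3) :
  A ^+ 3 \in (<[1]> + <[A]> + <[A * A]>)%VS.
Proof.
have := Cayley_Hamilton A.
have szp := size_char_poly A.
have lcp : (char_poly A)`_3 = 1.
  by have /monicP := char_poly_monic A; rewrite lead_coefE szp.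
rewrite -[char_poly A]coefK poly_def szp !big_ord_recr big_ord0 /= add0r lcp.
rewrite !rmorphD /= !horner_mxZ !rmorphXn /= horner_mx_X expr0 expr1 scale1r.
move=> /eqP; rewrite addr_eq0 eq_sym eqr_oppLR => /eqP ->.
by rewrite rpredN !memv_add ?memvZ ?memv_line.
Qed.

(** If the chain stops at 3 or at 4, simplicity makes it full there. Otherwise both inclusions are
    strict and the dimension count reaches 9 = dim M_3. *)
Lemma L0_4_full (F : fieldType) (S : seq 'M[F]_3) : generating S -> L0 S 4 = fullv.
Proof.
move=> gen; rewrite L0E.
have [/(generating_stable_full gen) L3|n43] :=
    boolP (powers_sum <<S>> 4 <= powers_sum <<S>> 3)%VS.
  by apply/eqP; rewrite eqEsubv subvf -L3 powers_sum_leS.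
have [/(generating_stable_full gen)//|n54] :=
    boolP (powers_sum <<S>> 5 <= powers_sum <<S>> 4)%VS.
have d9 := powers_sum4_dim (fun A _ => cube_mem A) n43 n54.
by apply/eqP; rewrite eqEdim subvf dimvf (leq_trans _ d9).
Qed.

(** * The extremal pair *)

(** Indices are plain numbers, so that products of matrix units are decided by comparing
    numerals. *)
Definition mxunit (F : fieldType) (i j : nat) : 'M[F]_3 := delta_mx (inord i) (inord j).

Lemma mxunitM (F : fieldType) (i j k l : nat) :
  (j < 3)%N -> (k < 3)%N -> mxunit F i j * mxunit F k l = mxunit F i l *+ (j == k).
Proof.
move=> j3 k3; rewrite /mxunit -[LHS]/(_ *m _) mul_delta_mx_cond.
by rewrite -val_eqE /= !inordK.
Qed.

(** With indices counted from 0, this is the pair E_12 + E_23, E_31. *)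
Definition long_pair (F : fieldType) : seq 'M[F]_3 :=
  [:: mxunit F 0 1 + mxunit F 1 2; mxunit F 2 0].

Lemma mxunit_sum (F : fieldType) (M : 'M[F]_3) :
  exists c : nat -> nat -> F, M = \sum_(i < 3) \sum_(j < 3) c i j *: mxunit F i j.
Proof.
exists (fun i j => M (inord i) (inord j)); rewrite {1}[M]matrix_sum_delta.
by do 2![apply: eq_bigr => ? _]; rewrite /mxunit !inord_val.
Qed.

Lemma long_pair_generating (F : fieldType) : generating (long_pair F).
Proof.
move=> U U1 SU UM.
set E := mxunit F; pose A := E 0%N 1%N + E 1%N 2; pose B := E 2 0%N.
have AU : A \in U by apply: SU; rewrite inE eqxx.
have BU : B \in U by apply: SU; rewrite !inE eqxx orbT.
have E02 : E 0%N 2 \in U.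
  suff <- : A * A = E 0%N 2 by exact: UM.
  by rewrite mulrDl !mulrDr !mxunitM //= ?(add0r, addr0).
have E10 : E 1%N 0%N \in U.
  suff <- : A * B = E 1%N 0%N by exact: UM.
  by rewrite mulrDl !mxunitM //= ?(add0r, addr0).
have E21 : E 2 1%N \in U.
  suff <- : B * A = E 2 1%N by exact: UM.
  by rewrite mulrDr !mxunitM //= ?(add0r, addr0).
have E00 : E 0%N 0%N \in U.
  by have := UM _ _ E02 BU; rewrite mxunitM.
have E11 : E 1%N 1%N \in U.
  by have := UM _ _ E10 AU; rewrite mulrDr !mxunitM //= addr0.
have E22 : E 2 2 \in U.
  by have := UM _ _ BU E02; rewrite mxunitM.
(* The idempotents E_00 = A A B and E_11 = A B A separate the two summands of A; this takes words of
   length 4. *)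
have E01 : E 0%N 1%N \in U.
  by have := UM _ _ E00 AU; rewrite mulrDr !mxunitM //= addr0.
have E12 : E 1%N 2 \in U.
  by have := UM _ _ E11 AU; rewrite mulrDr !mxunitM //= add0r.
apply/eqP; rewrite eqEsubv subvf; apply/subvP => M _.
have [c ->] := mxunit_sum M.
by rewrite !big_ord_recr !big_ord0 /= !add0r !rpredD ?memvZ.
Qed.

(** The nonzero words of length at most 3 are A, B and six matrix units. E_01 and E_12 occur only
    through their sum A, so one dimension is missing. *)
Lemma long_pair_dim (F : fieldType) : (\dim (L0 (long_pair F) 3) <= 8)%N.
Proof.
set E := mxunit F; pose A := E 0%N 1%N + E 1%N 2; pose B := E 2 0%N.
pose T := [:: A; B; E 0%N 2; E 1%N 0%N; E 2 1%N; E 0%N 0%N; E 1%N 1%N; E 2 2].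
apply: leq_trans (dim_span T); apply: dimvS.
have TM M : M \in T -> M \in <<T>>%VS by exact: memv_span.
have words2 : words (long_pair F) 2 = [:: E 0%N 2; E 1%N 0%N; E 2 1%N; 0].
  by rewrite /= !mulr1 !(mulrDl, mulrDr) !mxunitM //= ?(add0r, addr0).
have words3 : words (long_pair F) 3 =
    [:: 0; E 0%N 0%N; E 1%N 1%N; 0; E 2 2; 0; 0; 0].
  rewrite -[LHS]/[seq X * Y | X <- long_pair F, Y <- words (long_pair F) 2].
  by rewrite words2 /= !(mulrDl, mulr0) !mxunitM //= ?(add0r, addr0).
rewrite /L0 3?big_ltn // big_geq // addv0 words2 words3 /= !mulr1 !subv_add.
apply/and3P; split; apply/span_subvP => M; rewrite !inE;
  repeat (case/predU1P=> [->|]); try (move/eqP->); rewrite ?mem0v //;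
  by apply: TM; rewrite !inE eqxx ?orbT.
Qed.

Theorem mainTheorem4 (F : fieldType) : is_l0_Mn F 2 4.
Proof.
have full45 (S : seq 'M[F]_3) : generating S -> L0 S 4 = L0 S 5.
  move=> gen; apply/eqP; rewrite eqEsubv {2}(L0_4_full gen) subvf andbT.
  by rewrite !L0E powers_sum_leS.
split; last first.
  move=> S k gen [_ min]; rewrite leqNgt; apply/negP => /min; apply.
  exact: full45.
have gen := @long_pair_generating F.
exists (long_pair F); split=> //; split; first exact: full45.
move=> j j4 eqL.
(* A stop at j < 4 would make L_j full, hence also L_3, whose dimension is at most 8. *)
have Lj : L0 (long_pair F) j = fullv.
  by rewrite L0E; apply: generating_stable_full => //; rewrite -!L0E eqL.
have := leq_trans (dimvS _) (long_pair_dim F).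
move/(_ (L0 (long_pair F) j)); rewrite Lj dimvf /dim /= => h.
have /h // : (fullv <= L0 (long_pair F) 3)%VS.
by rewrite -Lj !L0E powers_sum_le.
Qed.
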